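(* Let $\mathcal{A}=\{A_1,\ldots,A_n\}\subset\mathbb{R}^{2\times2}$ be a finite family with extended family $$\mathcal{A}_1=\mathcal{A}\cup\{A_iA_j : A_i,A_j\in\mathcal{A},\ \det A_i<0,\ \det A_j<0,\ A_iA_j\neq cI \text{ for every scalar } c\},$$ such that all elements of $\mathcal{A}_1$ are diagonalizable. Assume that all elements of $\mathcal{A}_1$ are Vandergraft matrices, that the dominant eigenlines of matrices in $\mathcal{A}_1$ are separated from the non-dominant ones, and that $\mathcal{A}$ contains non-scalar matrices with different dominant eigenlines. Label the matrices so that $\det A_i<0$ for $i=1,\ldots,k$ and $\det A_i\ge 0$ for $i>k$ ($k=0$ if there are no negative determinants). Let $U=\{u_1,\ldots,u_N\}$ be the set of unit dominant eigenvectors of the non-scalar matrices in $\mathcal{A}_1$, one for each distinct dominant eigenline, with directions chosen so that $\operatorname{Cone}U$ is proper and its interior is free of non-dominant eigenlines of matrices in $\mathcal{A}_1$. Let $$\mathcal{K}=\operatorname{Cone}\{u_j,\ A_iu_j : i=1,\ldots,k;\ j=1,\ldots,N\}.$$ Then there exist $\mathcal{A}$-invariant proper cones if and only if the cone $\mathcal{K}$ is proper, its interior is free of the non-dominant eigenvectors of all matrices in $\mathcal{A}_1$, and the edges (boundary rays) of $\mathcal{K}$ are not collinear with eigenvectors of $A_i$, $i=1,\ldots,k$.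
   Context: All matrices are real. A set $\mathcal{K}\subseteq\mathbb{R}^n$ is a cone if $a\mathcal{K}\subseteq\mathcal{K}$ for all $a\ge 0$; a cone is proper if it is convex ($\mathcal{K}+\mathcal{K}\subseteq\mathcal{K}$), closed, pointed ($\mathcal{K}\cap-\mathcal{K}=\{0\}$) and solid (nonempty interior). $\mathcal{K}$ is $A$-invariant if $Ax\in\mathcal{K}$ for all $x\in\mathcal{K}$, and $\mathcal{A}$-invariant if it is $A$-invariant for every $A\in\mathcal{A}$. $\operatorname{Cone}X$ is the set of all finite linear combinations of elements of $X$ with non-negative coefficients. The indices $i=j$ are allowed in the definition of $\mathcal{A}_1$. A real $n\times n$ matrix $A$ is a Vandergraft matrix if (1) its spectral radius $\rho(A)$ is an eigenvalue of $A$, and (2) $\deg\rho(A)\ge\deg\lambda$ for every eigenvalue $\lambda$ with $|\lambda|=\rho(A)$, where $\deg\lambda$ is the multiplicity of $\lambda$ as a root of the minimal polynomial of $A$. For a $2\times 2$ Vandergraft matrix that is not a scalar multiple of $I$, the (one-dimensional) eigenspace for $\rho(A)$ is its dominant eigenline and the nonzero vectors in it are dominant eigenvectors; if $A$ has a second eigenvalue different from $\rho(A)$, the corresponding eigenspace is its non-dominant eigenline, with non-dominant eigenvectors the nonzero vectors in it. Scalar matrices contribute no eigenlines. The dominant eigenlines of matrices in $\mathcal{A}_1$ are separated from the non-dominant ones if there exist linearly independent vectors $v_1,v_2\in\mathbb{R}^2$ such that the interior of $\operatorname{Cone}\{v_1,v_2\}$ is free of the non-dominant eigenvectors of matrices in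 $\mathcal{A}_1$, while the interior of $\operatorname{Cone}\{v_1,-v_2\}$ is free of the dominant eigenvectors of non-scalar matrices in $\mathcal{A}_1$; moreover, each $v_j$ is allowed to be both a dominant eigenvector (of some non-scalar matrix in $\mathcal{A}_1$) and a non-dominant eigenvector (of some matrix in $\mathcal{A}_1$) only if all the matrices in $\mathcal{A}_1$ of which it is a non-dominant eigenvector have non-negative determinant. Under this condition a choice of directions of the $u_j$ as required in the claim exists. *)

(* Defs.v *)
From mathcomp Require Export all_boot all_order all_algebra.
From mathcomp Require Export all_classical all_reals all_analysis.
From mathcomp.real_closed Require Export complex.

Set Implicit Arguments.
Unset Strict Implicit.
Unset Printing Implicit Defensive.

Import Order.TTheory GRing.Theory Num.Theory.
Import numFieldTopology.Exports numFieldNormedType.Exports.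

Local Open Scope classical_set_scope.
Local Open Scope ring_scope.
Local Open Scope complex_scope.

Section Cones.
Variables (R : realType) (n : nat).
Implicit Types (K X : set 'cV[R]_n) (x y : 'cV[R]_n).

(* The topology on 'cV[R]_n is the product topology, i.e. that of R^n. *)
Definition proper_cone K : Prop :=
  [/\ forall (a : R) x, 0 <= a -> K x -> K (a *: x),
      forall x y, K x -> K y -> K (x + y),
      closed K,
      K `&` [set - x | x in K] = [set 0]
    & interior K !=set0].

Definition cone X : set 'cV[R]_n :=
  [set x | exists (m : nat) (c : 'I_m -> R) (y : 'I_m -> 'cV[R]_n),
     [/\ forall i, 0 <= c i, forall i, X (y i) & x = \sum_i c i *: y i]].

Definition invariant_under (A : 'M[R]_n) K : Prop :=
  forall x, K x -> K (A *m x).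

Definition collinear x y : Prop := ~~ free [:: x; y].

(* The ray spanned by x lies on the topological boundary of K. *)
Definition boundary_ray K x : Prop :=
  x != 0 /\ forall a : R, 0 <= a -> (closure K `\` interior K) (a *: x).

(* The default norm of 'cV[R]_n is the sup norm. *)
Definition euclidean_norm x : R := Num.sqrt (\sum_i x i 0 ^+ 2).

End Cones.

Section Spectral.
Variable R : realType.

(* [eigenvalue] refers to row vectors (left eigenvectors), while vectors are
   columns below; the eigenvalues are the same on both sides. *)
Definition complex_eigenvalue n (A : 'M[R]_n) (z : R[i]) : bool :=
  eigenvalue (map_mx (real_complex R) A) z.

Definition spectral_radius n (A : 'M[R]_n) : R :=
  sup [set r : R | exists2 z : R[i], complex_eigenvalue A z & `|z| = r%:C].

Definition eigenvalue_deg n (A : 'M[R]_n.+1) (z : R[i]) : nat :=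
  mup z (mxminpoly (map_mx (real_complex R) A)).

Definition vandergraft n (A : 'M[R]_n.+1) : Prop :=
  eigenvalue A (spectral_radius A) /\
  forall z : R[i], complex_eigenvalue A z -> `|z| = (spectral_radius A)%:C ->
    (eigenvalue_deg A z <= eigenvalue_deg A (spectral_radius A)%:C)%N.

Definition eigenvector n (A : 'M[R]_n) (x : 'cV[R]_n) : Prop :=
  x != 0 /\ exists a : R, A *m x = a *: x.

End Spectral.

(* The notions below are meant for Vandergraft matrices. *)
Section Planar.
Variable R : realType.
Implicit Types (A B : 'M[R]_2) (x v : 'cV[R]_2) (F S : set 'M[R]_2).

Definition dominant_eigenline A : set 'cV[R]_2 :=
  [set x | A *m x = spectral_radius A *: x].

Definition dominant_eigenvector A x : Prop :=
  [/\ ~~ is_scalar_mx A, x != 0 & dominant_eigenline A x].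

Definition nondominant_eigenvector A x : Prop :=
  [/\ ~~ is_scalar_mx A, x != 0 &
      exists2 a : R, a != spectral_radius A & A *m x = a *: x].

Definition extended_family F : set 'M[R]_2 :=
  F `|` [set M | exists A B, [/\ F A, F B, \det A < 0, \det B < 0 &
                               M = A *m B /\ ~~ is_scalar_mx (A *m B)]].

Definition dominant_of S x : Prop :=
  exists2 B, S B & dominant_eigenvector B x.

Definition nondominant_of S x : Prop :=
  exists2 B, S B & nondominant_eigenvector B x.

Definition separated S : Prop :=
  exists v1 v2 : 'cV[R]_2,
    [/\ free [:: v1; v2],
        forall x, interior (cone [set v1; v2]) x -> ~ nondominant_of S x,
        forall x, interior (cone [set v1; - v2]) x -> ~ dominant_of S x
      & forall v, v = v1 \/ v = v2 ->
          dominant_of S v -> nondominant_of S v ->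
          forall B, S B -> nondominant_eigenvector B v -> 0 <= \det B].

(* One unit vector u_j on each of the distinct dominant eigenlines of S. *)
Definition dominant_directions S (N : nat) (u : 'I_N -> 'cV[R]_2) : Prop :=
  (forall j, euclidean_norm (u j) = 1 /\ dominant_of S (u j)) /\
  (forall B, S B -> ~~ is_scalar_mx B ->
     exists! j, dominant_eigenline B (u j)).

End Planar.

(* Main.v *)
(* Each non-scalar B in A1 acts as x |-> l x + (rho - l) f(x) d, where d is a
   dominant eigenvector and f is a linear functional whose kernel is the
   non-dominant eigenline.  An invariant proper cone C contains f(x) d for every
   x in C: this vector is proportional to B x - l x if l <= 0, and is the limit
   of (B / rho)^m x if l > 0.  Hence C contains a dominant eigenvector of each
   B, its interior contains no non-dominant one, and, if some A_i with
   det A_i < 0 exists, all the u_j lie in one of C and -C, which therefore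
   contains K.  Such an A_i maps one side of its dominant eigenline to the
   other, so this eigenline is not an edge of K.

   Conversely K itself is invariant: a B in A1 with l >= 0 preserves every
   proper cone that contains d and has no non-dominant eigenvector of B in its
   interior, because f is nonnegative on such a cone; and if det A_i < 0 and
   det A_m < 0, then A_m A_i u_j is in K because A_m A_i is a nonnegative
   scalar or an element of A1 of positive determinant. *)

Require Import Defs.
From mathcomp Require Import ring lra.

Import Order.TTheory GRing.Theory Num.Theory.
Import numFieldTopology.Exports numFieldNormedType.Exports.
Local Open Scope classical_set_scope.
Local Open Scope ring_scope.

Set Implicit Arguments.
Unset Strict Implicit.
Unset Printing Implicit Defensive.

(** * Spectra of diagonalizable matrices and the rank-one splitting of planar ones *)

Section Spectrum.
Variable R : realType.

Lemma diagonalizableE (F : fieldType) n (B : 'M[F]_n) : diagonalizable B ->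
  exists (P : 'M[F]_n) (a : 'rV[F]_n),
    P \in unitmx /\ B = invmx P *m diag_mx a *m P.
Proof.
case=> P Pu /(diagonalizable_forLR Pu)[a]; rewrite mxpoly.conjVmx// => BE.
by exists P, a.
Qed.

(** Rows of [P] are left eigenvectors. Conversely, [v *m invmx P] is a left eigenvector of the
    diagonal matrix, and any nonzero coordinate of it gives the index. *)
Lemma eigenvalue_similar_diag (F : fieldType) n (P : 'M[F]_n) (a : 'rV[F]_n) z :
  P \in unitmx ->
  eigenvalue (invmx P *m diag_mx a *m P) z <-> exists j, z = a 0 j.
Proof.
move=> Pu; split.
  move/eigenvalueP => [v vE v0].
  have wE : (v *m invmx P) *m diag_mx a = z *: (v *m invmx P).
    by rewrite scalemxAl -vE -!mulmxA mulmxV// mulmx1.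
  have w0 : v *m invmx P != 0.
    by apply: contra_neq v0 => vP0; rewrite -[v](mulmxKV Pu) vP0 mul0mx.
  have /rV0Pn[j wj] := w0; exists j.
  move: (v *m _) wj wE => w wj /matrixP/(_ 0 j).
  by rewrite mul_mx_diag !mxE mulrC => E; exact/esym/(mulIf wj).
case=> j ->; apply/eigenvalueP; exists (row j P).
  by rewrite !mulmxA -row_mul mulmxV// row1 -rowE row_diag_mx -scalemxAl -rowE.
apply: contraTneq Pu => Pj.
rewrite unitmxE (expand_det_row _ j) big1 ?unitr0//.
by move=> i _; move/rowP/(_ i): Pj; rewrite !mxE => ->; rewrite mul0r.
Qed.

(** A supremum is an upper bound only of a set bounded above; the sum of all [|a 0 i|] bounds the
    moduli. *)
Lemma spectral_radius_ge n (P : 'M[R]_n) (a : 'rV[R]_n) j : P \in unitmx ->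
  `|a 0 j| <= spectral_radius (invmx P *m diag_mx a *m P).
Proof.
move=> Pu; set B := _ *m _.
have eigE z : complex_eigenvalue B z <-> exists i, z = (a 0 i)%:C%C.
  rewrite /complex_eigenvalue /B !map_mxM map_invmx map_diag_mx.
  rewrite eigenvalue_similar_diag ?map_unitmx//.
  by split=> -[i ->]; exists i; rewrite mxE.
have normE (x : R) : `|x%:C%C| = `|x|%:C%C :> R[i]%C.
  by rewrite normc_def/= expr0n addr0 sqrtr_sqr.
apply: ub_le_sup.
  exists (\sum_i `|a 0 i|) => r /= [z /eigE[i ->]].
  rewrite normE => /complexI <-; rewrite (bigD1 i)//= lerDl.
  exact: sumr_ge0.
by exists (a 0 j)%:C%C; [apply/eigE; exists j | rewrite normE].
Qed.

(** The spectral radius is at least [|c|], and being an eigenvalue it equals [c]. *)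
Lemma vandergraft_scalar n (c : R) : vandergraft (c%:M : 'M[R]_n.+1) -> 0 <= c.
Proof.
have E : c%:M = invmx 1%:M *m diag_mx (const_mx c) *m 1%:M :> 'M[R]_n.+1.
  by rewrite mulmx1 invmx1 mul1mx diag_const_mx.
have := @spectral_radius_ge n.+1 1%:M (const_mx c) ord0 (unitmx1 _ _).
rewrite -E mxE => cle [+ _]; rewrite [X in eigenvalue X]E.
case/eigenvalue_similar_diag; first exact: unitmx1.
by move=> j rE; rewrite rE mxE in cle; apply: le_trans cle.
Qed.

(* [f] is the linear functional with [f d = 1] whose kernel is the non-dominant
   eigenline, so [B] acts as [x |-> l x + (rho - l) f(x) d]. *)
Definition dominant_splitting (B : 'M[R]_2) (l : R) (f : 'rV[R]_2)
    (d : 'cV[R]_2) : Prop :=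
  [/\ - spectral_radius B <= l < spectral_radius B,
      forall x, B *m x = l *: x + ((spectral_radius B - l) * (f *m x) 0 0) *: d,
      (f *m d) 0 0 = 1
    & \det B = spectral_radius B * l].

Lemma dominant_splitting_exists (B : 'M[R]_2) :
  diagonalizable B -> vandergraft B -> ~~ is_scalar_mx B ->
  exists l f d, dominant_splitting B l f d.
Proof.
move=> /diagonalizableE[P [a [Pu BE]]] [] + _.
rewrite /dominant_splitting; have := fun j => spectral_radius_ge a j Pu.
rewrite -BE; move: (spectral_radius B) => r sr_ge.
rewrite [X in eigenvalue X]BE.
move=> /(eigenvalue_similar_diag a r Pu)[i rE] Bn.
have [i' i'i i'P] : exists2 i' : 'I_2, i' != i & forall k, k != i -> k = i'.
  exists (rev_ord i); first by case: (i) => -[|[]].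
  by move=> k; case: (i) (k) => -[|[]]//= ? [[|[]]]//= ? ?; apply/val_inj.
set l := a 0 i'.
have lr : `|l| <= r := sr_ge i'.
(* [diag_mx a] is a scalar matrix plus a rank-one one. Conjugation by [P] turns the latter into
   column [i] of [invmx P] times row [i] of [P]; these are the witnesses for [d] and [f]. *)
have DE : diag_mx a = l%:M + (r - l) *:
    (delta_mx i 0 *m (delta_mx 0 i : 'rV[R]_2)).
  rewrite mul_delta_mx; apply/matrixP => p q; rewrite !mxE.
  have [->|/i'P ->] := eqVneq p i; last first.
    by rewrite -/l /= mulr0 addr0.
  rewrite -rE /= [q == i]eq_sym; case: eqVneq => //= _; last by ring.
  by rewrite !mulr1n; ring.
have BE' : B = l%:M + (r - l) *: (col i (invmx P) *m row i P).
  rewrite BE DE mulmxDr mulmxDl mul_mx_scalar -scalemxAl mulVmx// scalemx1.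
  by rewrite -scalemxAr -scalemxAl !mulmxA -colE -mulmxA -rowE.
have rl : l != r.
  apply: contraNneq Bn => lrE.
  by rewrite BE' lrE subrr scale0r addr0 scalar_mx_is_scalar.
have fd : (row i P *m col i (invmx P)) 0 0 = 1.
  transitivity ((P *m invmx P) i i); last by rewrite mulmxV// mxE eqxx.
  by rewrite !mxE; apply: eq_bigr => k _; rewrite !mxE.
exists l, (row i P), (col i (invmx P)).
split.
- by move: lr; rewrite ler_norml lt_neqAle rl.
- move=> x; rewrite [LHS](congr1 (mulmx^~ x) BE') mulmxDl mul_scalar_mx.
  rewrite -scalemxAl -mulmxA [row i P *m x]mx11_scalar mul_mx_scalar scalerA.
  by rewrite -!mx11_scalar.
- by [].
rewrite [in LHS]BE !det_mulmx det_inv det_diag (bigD1 i)//= (bigD1 i')//=.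
rewrite big_pred0 ?mulr1; last first.
  by move=> k; case: (eqVneq k i) => //= /i'P ->; rewrite eqxx.
by rewrite -rE -/l; field; rewrite -unitfE -unitmxE.
Qed.
End Spectrum.

(** * Interiors, opposites and limits in a normed space *)

Section NormedModule.
Variables (R : realType) (V : normedModType R).
Implicit Types (K : set V) (x y w : V).

(** Translation by [y] carries a neighbourhood of [x] inside [K] into [K]. *)
Lemma interior_addr K x y : (forall x y, K x -> K y -> K (x + y)) ->
  interior K x -> K y -> interior K (x + y).
Proof.
move=> KD Kx Ky; have : (fun z => z - y) @ (x + y) --> x.
  rewrite -[X in _ --> X](addrK y); by apply: cvgB => //; exact: cvg_cst.
move=> /(_ _ Kx); apply: (@filterS _ (nbhs (x + y))).
by move=> z /= Kzy; rewrite -(subrK y z); exact: KD.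
Qed.

Lemma interior_absorbing K x w : interior K x ->
  exists2 e : R, 0 < e & K (x + e *: w).
Proof.
move=> Kx; have : (fun e : R => x + e *: w) @ (0 : R) --> x.
  rewrite -[X in _ --> X]addr0 -(scale0r w); apply: cvgD; first exact: cvg_cst.
  exact: scalel_continuous.
move=> /(_ _ Kx) /nbhs_ballP[e /= e0 eK].
exists (e / 2); first by rewrite divr_gt0.
apply: eK; rewrite /ball/= sub0r normrN gtr0_norm ?divr_gt0//.
by rewrite ltr_pdivrMr// mulr_natr mulr2n ltrDl.
Qed.

Lemma closedN K : closed K -> closed [set x | K (- x)].
Proof.
by move=> Kcl; apply: preimage_closed => // y _; exact: oppr_continuous.
Qed.

Lemma interiorN K x : interior K x -> interior [set x | K (- x)] (- x).
Proof.
move=> Kx; have := @oppr_continuous _ _ (- x).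
by rewrite /continuous_at opprK => /(_ _ Kx).
Qed.

Lemma closed_geometric K (q : R) x y : closed K -> `|q| < 1 ->
  (forall m, K (q ^+ m *: x + y)) -> K y.
Proof.
move=> Kcl q1 Km; have : (fun m => q ^+ m *: x + y) @ \oo --> y.
  rewrite -[X in _ --> X]add0r -(scale0r x); apply: cvgD; last exact: cvg_cst.
  by apply: cvgZr_tmp; exact: cvg_expr.
by apply: closed_cvg => //; exact: nearW.
Qed.

End NormedModule.

(** * Proper cones and generated cones in any dimension *)

Section ConvexCones.
Variables (R : realType) (n : nat).
Implicit Types (K X Y : set 'cV[R]_n) (x y w : 'cV[R]_n).

Lemma proper_cone0 K : proper_cone K -> K 0.
Proof.
by case=> _ _ _ K0 _; have [] : (K `&` [set - x | x in K]) 0 by rewrite K0.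
Qed.

Lemma proper_cone_pointed K x : proper_cone K -> K x -> K (- x) -> x = 0.
Proof.
case=> _ _ _ K0 _ Kx KNx; suff : [set 0] x by [].
by rewrite -K0; split=> //; exists (- x) => //; rewrite opprK.
Qed.

Lemma proper_cone_unscale K (a : R) x : proper_cone K -> 0 < a ->
  K (a *: x) -> K x.
Proof.
case=> KZ _ _ _ _ a0 /(KZ a^-1); rewrite scalerA mulVf ?gt_eqF// scale1r.
by apply; rewrite invr_ge0 ltW.
Qed.

Lemma proper_cone_neg K (a : R) x : proper_cone K -> a < 0 ->
  K x -> K (a *: x) -> x = 0.
Proof.
move=> pK a0 Kx; rewrite -[a]opprK scaleNr -scalerN => Kax.
apply: (proper_cone_pointed pK Kx); apply: proper_cone_unscale Kax => //.
by rewrite oppr_gt0.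
Qed.

Lemma collinear_scale x y : y != 0 -> collinear x y -> exists c : R, x = c *: y.
Proof.
move=> y0; rewrite /collinear free_cons seq1_free y0 andbT negbK span_seq1.
by move/vlineP.
Qed.

(** Were 0 interior, small positive multiples of [w] and [- w] would both lie in [K], against
    pointedness. *)
Lemma interior_neq0 K x w : proper_cone K -> w != 0 -> interior K x -> x != 0.
Proof.
move=> pK w0; apply: contraPneq => -> K0.
have [e e0] := interior_absorbing w K0.
have [e' e'0] := interior_absorbing (- w) K0.
rewrite !add0r.
move=> /(proper_cone_unscale pK e'0) KNw /(proper_cone_unscale pK e0) Kw.
by case/eqP: w0; exact: (proper_cone_pointed pK).
Qed.

Lemma proper_coneN K : proper_cone K -> proper_cone [set x | K (- x)].
Proof.
move=> pK; have [KZ KD Kcl K0 [x Kx]] := pK; split.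
- by move=> a y a0 /= Ky; rewrite -scalerN; exact: KZ.
- by move=> y z /= Ky Kz; rewrite opprD; exact: KD.
- exact: closedN.
- apply/seteqP; split=> [y /= [Ky [z Kz zE]]|y ->].
    by apply: (proper_cone_pointed pK) => //; rewrite -zE.
  rewrite /= oppr0; split; first exact: proper_cone0.
  by exists 0; rewrite oppr0//; exact: proper_cone0.
- by exists (- x); exact: interiorN.
Qed.

Lemma cone_sub X : X `<=` cone X.
Proof.
move=> x Xx; exists 1%N, (fun=> 1), (fun=> x); split=> //.
by rewrite big_ord1 scale1r.
Qed.

Lemma coneZ X (a : R) x : 0 <= a -> cone X x -> cone X (a *: x).
Proof.
move=> a0 [m [c [y [c0 Xy ->]]]]; exists m, (fun i => a * c i), y; split=> //.
  by move=> i; rewrite mulr_ge0.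
by rewrite scaler_sumr; apply: eq_bigr => i _; rewrite scalerA.
Qed.

Lemma coneD X x y : cone X x -> cone X y -> cone X (x + y).
Proof.
move=> [m [c [s [c0 Xs ->]]]] [m' [c' [s' [c'0 Xs' ->]]]].
exists (m + m')%N,
  (fun i : 'I_(m + m') =>
     match fintype.split i with inl j => c j | inr j => c' j end),
  (fun i : 'I_(m + m') =>
     match fintype.split i with inl j => s j | inr j => s' j end).
split.
- by move=> i; case: fintype.split.
- by move=> i; case: fintype.split.
- rewrite big_split_ord/=; congr (_ + _); apply: eq_bigr => i _.
    by rewrite (unsplitK (inl i)).
  by rewrite (unsplitK (inr i)).
Qed.

Lemma cone_min X K : (forall (a : R) x, 0 <= a -> K x -> K (a *: x)) ->
  (forall x y, K x -> K y -> K (x + y)) -> K 0 -> X `<=` K -> cone X `<=` K.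
Proof.
move=> KZ KD K0 XK x [m [c [y [c0 Xy ->]]]].
by elim/big_ind: _ => // i _; apply: KZ => //; exact: XK.
Qed.

Lemma coneS X Y : X `<=` Y -> cone X `<=` cone Y.
Proof.
by move=> XY x [m [c [y [c0 Xy xE]]]]; exists m, c, y; split=> // i; exact: XY.
Qed.

Lemma cone_min_proper X K : proper_cone K -> X `<=` K -> cone X `<=` K.
Proof.
move=> pK; have [KZ KD _ _ _] := pK.
by apply: cone_min => //; exact: proper_cone0.
Qed.

End ConvexCones.

(** Transitivity is asked only on [P], because the comparison by angle used below is transitive only
    among nonzero vectors of a pointed cone. *)
Lemma seq_least (T : eqType) (P : T -> Prop) (le : rel T) : total le ->
  (forall y x z, P x -> P y -> P z -> le x y -> le y z -> le x z) ->
  forall x0 s, (forall x, x \in x0 :: s -> P x) ->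
  exists2 p, p \in x0 :: s & forall x, x \in x0 :: s -> le p x.
Proof.
move=> le_total le_trans x0 s; elim: s x0 => [|x1 s IHs] x0 Ps.
  exists x0; rewrite ?mem_head// => x; rewrite inE => /eqP ->.
  by case/orP: (le_total x0 x0).
have [|p ps pP] := IHs x1; first by move=> x xs; apply: Ps; rewrite inE xs orbT.
have /orP[x0p|px0] := le_total x0 p; last first.
  exists p; first by rewrite inE ps orbT.
  by move=> x; rewrite inE => /predU1P[->|] //; exact: pP.
exists x0; rewrite ?mem_head// => x; rewrite inE => /predU1P[->|xs].
  by case/orP: (le_total x0 x0).
apply: le_trans x0p (pP _ xs); apply: Ps;
  by rewrite ?mem_head// inE ?ps ?xs orbT.
Qed.

Lemma continuous_lincomb2 (R : realType) (T : topologicalType) (a b : R)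
  (f g : T -> R) : continuous f -> continuous g ->
  continuous (fun x => a * f x - b * g x).
Proof.
by move=> fc gc x; apply: cvgB; apply: cvgM;
  [exact: cvg_cst|exact: fc|exact: cvg_cst|exact: gc].
Qed.

(** * Order by angle in the plane and closedness of finitely generated cones *)

Section PlanarCones.
Variable R : realType.
Implicit Types (K X : set 'cV[R]_2) (x y z : 'cV[R]_2).

(** The determinant with columns [x] and [y], positive when [y] is less than a half turn
    counterclockwise from [x]. *)
Definition cross x y : R := x 0 0 * y 1 0 - x 1 0 * y 0 0.

Lemma cV2P x y : x 0 0 = y 0 0 -> x 1 0 = y 1 0 -> x = y.
Proof.
move=> E0 E1; apply/matrixP => i j; rewrite (ord1 j).
have [->|->//] : i = 0 \/ i = 1; last by [].
by case: i => -[|[|//]] lti; [left|right]; exact: val_inj.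
Qed.

Lemma crossC x y : cross x y = - cross y x.
Proof. rewrite /cross; ring. Qed.

Lemma crossDr x y z : cross x (y + z) = cross x y + cross x z.
Proof. rewrite /cross !mxE; ring. Qed.

Lemma crossZr x y (a : R) : cross x (a *: y) = a * cross x y.
Proof. rewrite /cross !mxE; ring. Qed.

(** Cramer's rule, as the linear relation among three vectors of the plane. *)
Lemma cross_cyclic x y z :
  cross y z *: x + cross z x *: y + cross x y *: z = 0.
Proof. by apply: cV2P; rewrite /cross !mxE; ring. Qed.

Lemma cross_continuous x : continuous (cross x).
Proof.
exact: (@continuous_lincomb2 _ _ _ _ (fun y : 'cV[R]_2 => y 1 0)
  (fun y : 'cV[R]_2 => y 0 0)
  (@coord_continuous _ _ _ _ _) (@coord_continuous _ _ _ _ _)).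
Qed.

(** If [cross x z < 0], then [cross_cyclic] makes the opposite of [cross z x *: y] a nonnegative
    combination of [x] and [z], so pointedness forces [y = 0]. *)
Lemma cross_trans K x y z : proper_cone K -> y != 0 -> K x -> K y -> K z ->
  0 <= cross x y -> 0 <= cross y z -> 0 <= cross x z.
Proof.
move=> pK y0 Kx Ky Kz xy yz; have [KZ KD _ _ _] := pK.
rewrite leNgt; apply/negP => xz.
have zx : 0 < cross z x by rewrite crossC oppr_gt0.
have : cross z x *: y = 0.
  apply: (proper_cone_pointed pK); first exact/KZ/Ky/ltW.
  have := cross_cyclic x y z; rewrite addrAC => /eqP.
  rewrite addr_eq0 => /eqP <-.
  by apply: KD; exact: KZ.
by move/eqP; rewrite scaler_eq0 (negbTE y0) gt_eqF.
Qed.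

Lemma cross_least K x0 s : proper_cone K ->
  (forall x, x \in x0 :: s -> K x /\ x != 0) ->
  exists2 p, p \in x0 :: s & forall x, x \in x0 :: s -> 0 <= cross p x.
Proof.
move=> pK.
apply: (@seq_least _ (fun x => K x /\ x != 0) (fun x y => 0 <= cross x y)).
  by move=> x y; rewrite [cross y x]crossC oppr_ge0 le_total.
by move=> y x z [Kx _] [Ky y0] [Kz _] xy yz; exact: (cross_trans pK y0).
Qed.

Lemma cross_greatest K x0 s : proper_cone K ->
  (forall x, x \in x0 :: s -> K x /\ x != 0) ->
  exists2 q, q \in x0 :: s & forall x, x \in x0 :: s -> 0 <= cross x q.
Proof.
move=> pK.
apply: (@seq_least _ (fun x => K x /\ x != 0) (fun x y => 0 <= cross y x)).
  by move=> x y; rewrite [cross y x]crossC oppr_ge0 le_total.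
by move=> y x z [Kx _] [Ky y0] [Kz _] yx zy; exact: (cross_trans pK y0).
Qed.

(** The generators [p] and [q] extreme in angle bound the cone. If [cross p q > 0], it is the
    intersection of two closed half-planes; otherwise it lies on the line of [p], which a nonempty
    interior excludes. *)
Lemma closed_cone_seq K x0 s : proper_cone K ->
  (forall x, x \in x0 :: s -> K x /\ x != 0) ->
  interior (cone [set` x0 :: s]) !=set0 -> closed (cone [set` x0 :: s]).
Proof.
move=> pK Ks [z zint]; have [KZ KD _ _ _] := pK.
have [p ps pP] := cross_least pK Ks; have [q qs qP] := cross_greatest pK Ks.
have [[Kp p0] [Kq q0]] := (Ks _ ps, Ks _ qs).
have pPc x : cone [set` x0 :: s] x -> 0 <= cross p x.
  apply: (@cone_min _ _ _ [set x | 0 <= cross p x]) => //=.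
  - by move=> a y a0 y0; rewrite crossZr mulr_ge0.
  - by move=> y w y0 w0; rewrite crossDr addr_ge0.
  - by rewrite /cross !mxE !mulr0 subrr.
have qPc x : cone [set` x0 :: s] x -> 0 <= cross x q.
  rewrite crossC oppr_ge0.
  apply: (@cone_min _ _ _ [set x | cross q x <= 0]) => //=.
  - by move=> a y a0 y0; rewrite crossZr mulr_ge0_le0.
  - by move=> y w y0 w0; rewrite crossDr -[leRHS]addr0 lerD.
  - by rewrite /cross !mxE !mulr0 subrr.
  - by move=> y /= /qP; rewrite crossC oppr_ge0.
have [pq0|pq] := eqVneq (cross p q) 0; last first.
  have {}pq : 0 < cross p q by rewrite lt_neqAle eq_sym pq qP.
  rewrite (_ : cone _ = [set x | 0 <= cross p x] `&` [set x | cross q x <= 0]).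
    apply: closedI.
      apply: (@preimage_closed _ _ (cross p) [set a | 0 <= a]);
        last exact: closed_ge.
      by move=> x _; exact: cross_continuous.
    apply: (@preimage_closed _ _ (cross q) [set a | a <= 0]);
      last exact: closed_le.
    by move=> x _; exact: cross_continuous.
  apply/seteqP; split=> [x sx|x /= [px qx]].
    by split=> /=; rewrite ?pPc// -oppr_ge0 -crossC qPc.
  have -> : x = (cross p q)^-1 *: (cross x q *: p + cross p x *: q).
    by apply: cV2P; rewrite /cross !mxE; field; rewrite lt0r_neq0.
  apply: coneZ; first by rewrite invr_ge0 ltW.
  apply: coneD; apply: coneZ; [|exact: cone_sub| |exact: cone_sub] => //.
  by rewrite crossC oppr_ge0.
have flat x : cone [set` x0 :: s] x -> cross p x = 0.
  apply: (@cone_min _ _ _ [set x | cross p x = 0]) => //=.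
  - by move=> a y a0 y0; rewrite crossZr y0 mulr0.
  - by move=> y w y0 w0; rewrite crossDr y0 w0 addr0.
  - by rewrite /cross !mxE !mulr0 subrr.
  (* With [cross p q = 0], the cyclic relation makes [cross p y *: q] the opposite of a nonnegative
     multiple of [p], so pointedness kills it. *)
  move=> y ys; have : cross p y *: q = 0.
    apply: (proper_cone_pointed pK); first exact/KZ/Kq/pP.
    have := cross_cyclic p y q.
    rewrite [cross q p]crossC pq0 oppr0 scale0r addr0.
    by move/eqP; rewrite addr_eq0 => /eqP <-; exact/KZ/Kp/qP.
  by move/eqP; rewrite scaler_eq0 (negbTE q0) orbF => /eqP.
(* [w] is [p] turned by a right angle, so [cross p w] is the squared Euclidean length of [p]. *)
pose w : 'cV[R]_2 := \col_i (if i == 0 then - p 1 0 else p 0 0).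
have [e e0 /flat] := interior_absorbing w zint.
rewrite crossDr crossZr flat; last exact: interior_subset zint.
rewrite add0r => /eqP.
rewrite mulf_eq0 gt_eqF//= /cross !mxE/= mulrN opprK -!expr2.
rewrite paddr_eq0 ?sqr_ge0// !sqrf_eq0 => /andP[/eqP p00 /eqP p10].
by case/eqP: p0; apply: cV2P; rewrite ?p00 ?p10 mxE.
Qed.

End PlanarCones.

Lemma det_lt0_nonscalar (R : realType) (B : 'M[R]_2) :
  \det B < 0 -> ~~ is_scalar_mx B.
Proof.
apply: contraTN => /is_scalar_mxP[c ->].
by rewrite det_scalar -leNgt sqr_ge0.
Qed.

(** * Action of a split matrix and the proper cones it preserves *)

Section Splitting.
Variables (R : realType) (B : 'M[R]_2) (l : R) (f : 'rV[R]_2) (d : 'cV[R]_2).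
Implicit Types (K C : set 'cV[R]_2) (x y : 'cV[R]_2).
Local Notation r := (spectral_radius B).
Local Notation fc x := ((f *m x) 0 0).
Hypothesis Bs : dominant_splitting B l f d.

Let fD x y : fc (x + y) = fc x + fc y. Proof. by rewrite mulmxDr mxE. Qed.
Let fZ (a : R) x : fc (a *: x) = a * fc x.
Proof. by rewrite -scalemxAr mxE. Qed.

Let lr : l < r. Proof. by case: Bs => /andP[]. Qed.
Let rl0 : 0 < r - l. Proof. by rewrite subr_gt0. Qed.
Let BE x : B *m x = l *: x + ((r - l) * fc x) *: d. Proof. by case: Bs. Qed.
Let fd : fc d = 1. Proof. by case: Bs. Qed.

Lemma splitting_radius_gt0 : 0 < r.
Proof. by case: Bs => /andP[]; lra. Qed.

Lemma splitting_eigenE : B *m d = r *: d.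
Proof. by rewrite BE fd mulr1 -scalerDl addrC subrK. Qed.

Lemma splitting_neq0 : d != 0.
Proof.
by apply: contra_eq_neq fd => ->; rewrite mulmx0 mxE eq_sym oner_eq0.
Qed.

Lemma splitting_dominant x : B *m x = r *: x -> x = fc x *: d.
Proof.
move=> Bx; apply: (scalerI (lt0r_neq0 rl0)).
by rewrite scalerA scalerBl -Bx BE addrAC subrr add0r.
Qed.

(** [f] is a left eigenvector for the spectral radius, and it annihilates right eigenvectors of any
    other eigenvalue. *)
Lemma splitting_eigen_ker (a : R) x : a != r -> B *m x = a *: x -> fc x = 0.
Proof.
move=> ar Bx; have : fc (B *m x) = r * fc x.
  by rewrite BE fD !fZ fd; ring.
rewrite Bx fZ => /eqP; rewrite -subr_eq0 -mulrBl mulf_eq0 subr_eq0 (negbTE ar).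
by move/eqP.
Qed.

Lemma splitting_ker x : fc x = 0 -> B *m x = l *: x.
Proof. by move=> fx; rewrite BE fx mulr0 scale0r addr0. Qed.

Lemma splitting_nondominant x : ~~ is_scalar_mx B -> x != 0 -> fc x = 0 ->
  nondominant_eigenvector B x.
Proof.
by move=> Bn x0 /splitting_ker Bx; split=> //; exists l; rewrite ?lt_eqF.
Qed.

Lemma splitting_det_ge0 : 0 <= \det B -> 0 <= l.
Proof. by case: Bs => _ _ _ ->; rewrite pmulr_rge0// splitting_radius_gt0. Qed.

Lemma splitting_det_lt0 : \det B < 0 -> l < 0.
Proof. by case: Bs => _ _ _ ->; rewrite pmulr_rlt0// splitting_radius_gt0. Qed.

Lemma invariant_dominant_part C x : proper_cone C -> invariant_under B C ->
  C x -> C (fc x *: d).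
Proof.
move=> pC CB Cx; have [CZ CD Ccl _ _] := pC.
have [l0|l0] := leP l 0.
  have : C ((r - l) *: (fc x *: d)).
    rewrite (_ : _ *: _ = B *m x + (- l) *: x).
      by apply: CD; [exact: CB|apply: CZ; rewrite ?oppr_ge0].
    by rewrite BE scaleNr addrAC subrr add0r scalerA.
  exact: proper_cone_unscale.
have r0 := splitting_radius_gt0.
(* Here [y] is the non-dominant part and [z] the dominant part of a vector of [C];
   [(l / r) ^+ m *: y + z] is its image under the [m]-th power of [B / r], which stays in [C]. *)
have powerlim y z : B *m y = l *: y -> B *m z = r *: z -> C (y + z) -> C z.
  move=> By Bz Cyz; apply: (@closed_geometric _ _ _ (l / r) y) => //.
    by rewrite gtr0_norm ?divr_gt0// ltr_pdivrMr// mul1r.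
  elim=> [|m IHm]; first by rewrite expr0 scale1r.
  rewrite (_ : _ + _ = r^-1 *: (B *m ((l / r) ^+ m *: y + z))).
    by apply: CZ; [rewrite invr_ge0 ltW|exact: CB].
  rewrite mulmxDr -scalemxAr By Bz scalerDr !scalerA mulVf ?gt_eqF// scale1r.
  by rewrite exprS; congr (_ *: _ + _); ring.
apply: (@powerlim (x - fc x *: d)); last by rewrite subrK.
  by apply: splitting_ker; rewrite -scaleN1r fD !fZ fd; ring.
by rewrite -scalemxAr splitting_eigenE !scalerA mulrC.
Qed.

(** Wherever [f] is nonzero, the dominant part is a nonzero multiple of [d]. If [f] vanishes at the
    chosen interior point, a small move along [d] stays in [C] and makes it nonzero. *)
Lemma invariant_dominant C : proper_cone C -> invariant_under B C ->
  C d \/ C (- d).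
Proof.
move=> pC CB; have [CZ CD _ _ [p Cp]] := pC.
have sgn x : C x -> fc x != 0 -> C d \/ C (- d).
  move=> /(invariant_dominant_part pC CB) Cx.
  rewrite neq_lt => /orP[fx|fx]; [right|left].
    apply: (@proper_cone_unscale _ _ _ (- fc x)); rewrite ?oppr_gt0//.
    by rewrite scaleNr scalerN opprK.
  exact: proper_cone_unscale Cx.
have [fp0|] := eqVneq (fc p) 0; last first.
  by apply: sgn; exact: interior_subset.
have [e e0 /sgn] := interior_absorbing d Cp; apply.
by rewrite fD fZ fd fp0 mulr1 add0r gt_eqF.
Qed.

(** If [f] vanished at an interior point, small moves along [d] and [- d] would stay in [C], and
    their dominant parts would put both [d] and [- d] in [C]. *)
Lemma interior_not_nondominant C x : proper_cone C -> invariant_under B C ->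
  interior C x -> ~ nondominant_eigenvector B x.
Proof.
move=> pC CB Cx [_ _ [a ar /(splitting_eigen_ker ar) fx]].
have [e e0 /(invariant_dominant_part pC CB)] := interior_absorbing d Cx.
have [e' e'0 /(invariant_dominant_part pC CB)] := interior_absorbing (- d) Cx.
rewrite -scaleN1r !fD !fZ fd fx !add0r !mulr1 mulrN1 scaleNr -scalerN.
move=> /(proper_cone_unscale pC e'0) CNd /(proper_cone_unscale pC e0) Cd.
by have /eqP := splitting_neq0; apply; exact: (proper_cone_pointed pC).
Qed.

(** If [f] were nonpositive at [x], adding [- f(x)] times [d] would reach the kernel without leaving
    the interior. *)
Lemma splitting_functional_gt0 K x : proper_cone K -> K d ->
  (forall y, interior K y -> fc y <> 0) -> interior K x -> 0 < fc x.
Proof.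
move=> pK Kd Kf Kx; rewrite ltNge; apply/negP => fx; have [KZ KD _ _ _] := pK.
apply: (Kf (x + (- fc x) *: d)); last by rewrite fD fZ fd mulr1 subrr.
by apply: interior_addr => //; apply: KZ; rewrite ?oppr_ge0.
Qed.

(** If [f] were negative at [x], an interior point, where [f] is positive, plus a suitable positive
    multiple of [x] would be an interior point in the kernel. *)
Lemma splitting_functional_ge0 K x : proper_cone K -> K d ->
  (forall y, interior K y -> fc y <> 0) -> K x -> 0 <= fc x.
Proof.
move=> pK Kd Kf Kx; rewrite leNgt; apply/negP => fx.
have [KZ KD _ _ [p Kp]] := pK.
have fp := splitting_functional_gt0 pK Kd Kf Kp.
apply: (Kf (p + (fc p / - fc x) *: x)); last first.
  by rewrite fD fZ; field; rewrite lt_eqF.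
by apply: interior_addr => //; apply: KZ; rewrite // divr_ge0// ?ltW// oppr_gt0.
Qed.

Lemma splitting_invariant K : proper_cone K -> K d ->
  (forall y, interior K y -> fc y <> 0) -> 0 <= l -> invariant_under B K.
Proof.
move=> pK Kd Kf l0 x Kx; have [KZ KD _ _ _] := pK; rewrite BE.
apply: KD; apply: KZ => //; apply: mulr_ge0; first exact: ltW.
exact: splitting_functional_ge0 Kx.
Qed.

End Splitting.

(** Rescaling [f] and [d] by inverse factors puts the prescribed eigenvector in the place of [d], so
    that the [u j] themselves serve in splittings. *)
Lemma splitting_at (R : realType) (B : 'M[R]_2) (u : 'cV[R]_2) :
  diagonalizable B -> vandergraft B -> dominant_eigenvector B u ->
  exists l f, dominant_splitting B l f u.
Proof.
move=> dB vB [Bn u0 Bu].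
have [l [f [d Bs]]] := dominant_splitting_exists dB vB Bn.
have uE := splitting_dominant Bs Bu; have [lr BE fd dt] := Bs.
set c := (f *m u) 0 0 in uE.
have c0 : c != 0 by apply: contra_neq u0 => c0; rewrite uE c0 scale0r.
have fcE y : ((c^-1 *: f) *m y) 0 0 = c^-1 * (f *m y) 0 0.
  by rewrite -scalemxAl mxE.
exists l, (c^-1 *: f); split=> //.
- move=> x; rewrite BE fcE [in RHS]uE scalerA; congr (_ + _ *: _).
  by field.
- by rewrite fcE mulVf.
Qed.

Theorem theorem8 (R : realType) (n : nat) (A : 'I_n -> 'M[R]_2)
  (k : nat) (N : nat) (u : 'I_N -> 'cV[R]_2) :
  let A1 := extended_family (range A) in
  let K := cone (range u `|`
                 [set y | exists (i : 'I_n) (j : 'I_N),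
                            (i < k)%N /\ y = A i *m u j]) in
  (forall B, A1 B -> diagonalizable B) ->
  (forall B, A1 B -> vandergraft B) ->
  separated A1 ->
  (exists i j : 'I_n,
     [/\ ~~ is_scalar_mx (A i), ~~ is_scalar_mx (A j)
       & dominant_eigenline (A i) <> dominant_eigenline (A j)]) ->
  (k <= n)%N ->
  (forall i : 'I_n, (i < k)%N -> \det (A i) < 0) ->
  (forall i : 'I_n, (k <= i)%N -> 0 <= \det (A i)) ->
  dominant_directions A1 u ->
  proper_cone (cone (range u)) ->
  (forall x, interior (cone (range u)) x -> ~ nondominant_of A1 x) ->
  (exists C : set 'cV[R]_2,
     proper_cone C /\ forall i : 'I_n, invariant_under (A i) C)
  <->
  [/\ proper_cone K,
      forall x, interior K x -> ~ nondominant_of A1 x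
    & forall (x y : 'cV[R]_2) (i : 'I_n), (i < k)%N ->
        boundary_ray K x -> eigenvector (A i) y -> ~ collinear x y].
Proof.
move=> A1 K A1diag A1vand _ _ _ Aneg Apos [uS uU] pU Ufree.
have A1A i : A1 (A i) by left; exists i.
have A1AA i j : \det (A i) < 0 -> \det (A j) < 0 ->
    ~~ is_scalar_mx (A i *m A j) -> A1 (A i *m A j).
  by move=> Ai Aj Aij; right; exists (A i), (A j).
have split_u B : A1 B -> ~~ is_scalar_mx B ->
    exists j l f, dominant_splitting B l f (u j).
  move=> AB Bn; have [j [Bu _]] := uU B AB Bn; exists j.
  apply: splitting_at; [exact: A1diag|exact: A1vand|split=> //].
  by have [_ [B0 _ []]] := uS j.
have Uu j : cone (range u) (u j) by apply: cone_sub; exists j.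
have Ku j : K (u j) by apply: cone_sub; left; exists j.
have KAu (i : 'I_n) j : (i < k)%N -> K (A i *m u j).
  by move=> ik; apply: cone_sub; right; exists i, j.
have UK : cone (range u) `<=` K. by apply: coneS => y; left.
(* Kernel vectors of [f] interior to [X] are nonzero, hence non-dominant eigenvectors of [B]. *)
have free_ker X B l f d : proper_cone X ->
    (forall x, interior X x -> ~ nondominant_of A1 x) ->
    A1 B -> ~~ is_scalar_mx B -> dominant_splitting B l f d ->
    forall y, interior X y -> (f *m y) 0 0 <> 0.
  move=> pX Xfree AB Bn Bs y Xy fy; apply: (Xfree _ Xy); exists B => //.
  apply: (splitting_nondominant Bs) => //.
  exact: (interior_neq0 pX (splitting_neq0 Bs)).
split; last first.
  move=> [pK Kfree _]; exists K; split=> // i.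
  have [ki|ik] := leqP k i.
    have [/is_scalar_mxP[c Ac]|An] := boolP (is_scalar_mx (A i)).
      move=> x Kx; rewrite Ac mul_scalar_mx; apply: coneZ => //.
      by apply: (@vandergraft_scalar _ 1); rewrite -Ac; exact: A1vand.
    have [j [l [f As]]] := split_u _ (A1A i) An.
    apply: (splitting_invariant As) => //; first exact: free_ker As.
    by apply: (splitting_det_ge0 As); exact: Apos.
  (* For a negative determinant, linearity reduces invariance to the generators of [K]. *)
  apply: (@cone_min _ _ _ [set x | K (A i *m x)]) => [a x a0|x y||].
  - by rewrite /= -scalemxAr; exact: coneZ.
  - by rewrite /= mulmxDr; exact: coneD.
  - by rewrite /= mulmx0; exact: proper_cone0.
  move=> _ [[j _ <-]|[i' [j [i'k ->]]]] /=; first exact: KAu.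
  rewrite mulmxA.
  have [/is_scalar_mxP[c Mc]|Mn] := boolP (is_scalar_mx (A i *m A i')).
    rewrite Mc mul_scalar_mx; have [c0|c0] := leP 0 c.
      by apply: coneZ => //; exact: Ku.
    (* A negative scalar [c] is impossible: on a dominant eigenvector [u j'] of [A i'], the matrix
       [A i] would act as [c] over the spectral radius of [A i'], so [K] would contain a negative
       multiple of its own generator [u j']. *)
    have An := det_lt0_nonscalar (Aneg _ i'k).
    have [j' [l [f As]]] := split_u _ (A1A i') An.
    have r0 := splitting_radius_gt0 As.
    have E : A i *m u j' = (c / spectral_radius (A i')) *: u j'.
      apply: (scalerI (lt0r_neq0 r0)).
      rewrite scalerA mulrCA mulfV ?lt0r_neq0// mulr1 -[c *: _]mul_scalar_mx.
      by rewrite -Mc -mulmxA (splitting_eigenE As) -scalemxAr.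
    have /eqP[] := splitting_neq0 As.
    apply: (@proper_cone_neg _ _ K (c / spectral_radius (A i'))) => //.
      by rewrite pmulr_llt0 ?invr_gt0.
    by rewrite -E; exact: KAu.
  have AM := A1AA _ _ (Aneg _ ik) (Aneg _ i'k) Mn.
  have [j' [l [f Ms]]] := split_u _ AM Mn.
  apply: (splitting_invariant Ms) => //; first exact: free_ker Ms.
  apply: (splitting_det_ge0 Ms).
  by rewrite det_mulmx ltW// nmulr_rgt0; exact: Aneg.
move=> [C0 [pC0 C0A]].
(* Without negative determinants [K] is the cone of the [u j], whose properties are assumed, and the
   edge condition is vacuous. *)
have [[m mk]|nok] := pselect (exists m : 'I_n, (m < k)%N); last first.
  have -> : K = cone (range u).
    rewrite /K; congr cone; apply/seteqP; split=> [y|y]; last by left.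
    by case=> // -[i [j [ik _]]]; case: nok; exists i.
  by split=> // x y i ik; case: nok; exists i.
have inv_A1 C : (forall i, invariant_under (A i) C) ->
    forall B, A1 B -> invariant_under B C.
  move=> CA B [[i _ <-]|[_ [_ [[i _ <-] [j _ <-] _ _ [-> _]]]]] x Cx.
    exact: CA.
  rewrite -mulmxA; exact/(CA i)/(CA j).
have Amn := det_lt0_nonscalar (Aneg _ mk).
have [j0 [l [f As]]] := split_u _ (A1A m) Amn.
have l0 := splitting_det_lt0 As (Aneg _ mk).
(* Replacing [C0] by its opposite if necessary puts [u j0] in the cone; the other [u j] are then
   compared with [u j0] through [A m]. *)
have [C [pC CA Cj0]] : exists C,
    [/\ proper_cone C, forall i, invariant_under (A i) C & C (u j0)].
  have [Cu|Cu] := invariant_dominant As pC0 (C0A m); first by exists C0.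
  exists [set x | C0 (- x)]; split=> //; first exact: proper_coneN.
  by move=> i x /= Cx; rewrite -mulmxN; exact: C0A.
have CB := inv_A1 _ CA.
have Cu j : C (u j).
  have [_ [B AB uB]] := uS j; have [_ uj0 _] := uB.
  have [lj [fj Bs]] := splitting_at (A1diag _ AB) (A1vand _ AB) uB.
  (* Suppose [- u j] is in [C]. As [f] is nonnegative on the cone of the [u j], the dominant part of
     [- u j] under [A m] forces [f] to vanish at [u j]. Then [A m] multiplies [- u j] by [l < 0],
     against pointedness of [C]. *)
  have [//|CN] := invariant_dominant Bs pC (CB _ AB).
  have fuj : 0 <= (f *m u j) 0 0.
    by apply: (splitting_functional_ge0 As pU) => //; exact: free_ker As.
  have := invariant_dominant_part As pC (CA m) CN.
  rewrite mulmxN mxE scaleNr => CNfu.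
  have /eqP : (f *m u j) 0 0 *: u j0 = 0.
    by apply: (proper_cone_pointed pC) CNfu; have [CZ _ _ _ _] := pC; exact: CZ.
  rewrite scaler_eq0 (negbTE (splitting_neq0 As)) orbF.
  move=> /eqP/(splitting_ker As) Au.
  case/eqP: uj0; apply: oppr_inj; rewrite oppr0.
  apply: (proper_cone_neg pC l0) => //.
  by rewrite scalerN -Au -mulmxN; exact: CA.
have gens y : (range u `|` [set y | exists (i : 'I_n) (j : 'I_N),
    (i < k)%N /\ y = A i *m u j]) y -> C y /\ y != 0.
  have u0 j : u j != 0 by have [_ [B _ []]] := uS j.
  case=> [[j _ <-]//|[i [j [ik ->]]]]; split; first exact: CA.
  have Au : A i \in unitmx by rewrite unitmxE unitfE ltr0_neq0// Aneg.
  by apply: contra_neq (u0 j) => Au0; rewrite -[u j](mulKmx Au) Au0 mulmx0.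
have KC : K `<=` C by apply: cone_min_proper => // y /gens[].
have intK : interior (cone (range u)) `<=` interior K by exact: interiorS.
have pK : proper_cone K.
  split; [exact: coneZ|exact: coneD| | |]; last first.
  - by have [_ _ _ _ [p /intK Kp]] := pU; exists p.
  - apply/seteqP; split=> [x [Kx [y Ky yx]]|_ ->].
      apply: (proper_cone_pointed pC); first exact: KC.
      by rewrite -yx opprK; exact: KC.
    by split; [|exists 0; rewrite ?oppr0//]; apply: UK; exact: proper_cone0.
  (* Closedness: the generators form a finite list of nonzero vectors of the proper cone [C], and
     [K] already has an interior point. *)
  pose s := [seq u j | j <- enum 'I_N] ++
    [seq A ij.1 *m u ij.2 | ij : 'I_n * 'I_N <- enum {: 'I_n * 'I_N}
                          & (ij.1 < k)%N].
  have sE : range u `|` [set y | exists (i : 'I_n) (j : 'I_N),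
      (i < k)%N /\ y = A i *m u j] = [set` s].
    apply/seteqP; split=> y /=; rewrite mem_cat.
      case=> [[j _ <-]|[i [j [ik ->]]]]; apply/orP; [left|right].
        by apply/mapP; exists j; rewrite ?mem_enum.
      by apply/mapP; exists (i, j) => //; rewrite mem_filter ik mem_enum.
    case/orP=> /mapP[j js ->]; first by left; exists j.
    right; exists j.1, j.2; split=> //.
    by move: js; rewrite mem_filter => /andP[].
  have us : u j0 \in s by rewrite mem_cat map_f ?mem_enum.
  have [_ _ _ _ [p /intK Kp]] := pU.
  move: us Kp; rewrite /K sE; have : forall x, x \in s -> C x /\ x != 0.
    by move=> x xs; apply: gens; rewrite sE.
  case: s {sE} => // x0 s Cs _ Kp; apply: (closed_cone_seq pC) => //.
  by exists p.
have Kfree x : interior K x -> ~ nondominant_of A1 x.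
  move=> Kx [B AB Bx]; have [Bn _ _] := Bx.
  have [lB [fB [d Bs]]] :=
    dominant_splitting_exists (A1diag _ AB) (A1vand _ AB) Bn.
  exact: (interior_not_nondominant Bs pC (CB _ AB) (interiorS KC Kx) Bx).
split=> // x y i ik [x0 xbd] [y0 [a Ay]] /(collinear_scale y0)[c xE].
have {y y0 Ay c xE} Ax : A i *m x = a *: x.
  by rewrite xE -scalemxAr Ay !scalerA mulrC.
have Kx : K x.
  have [_ _ Kcl _ _] := pK.
  by have [] := xbd 1 ler01; rewrite scale1r -(closure_id _).1.
have Ain := det_lt0_nonscalar (Aneg _ ik).
have {l f As l0} [j [l [f As]]] := split_u _ (A1A i) Ain.
have l0 := splitting_det_lt0 As (Aneg _ ik).
(* An edge on the non-dominant eigenline would be multiplied by [l < 0] inside the pointed cone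
   [C]. *)
have [ar|ar] := eqVneq a (spectral_radius (A i)); last first.
  have Axl := splitting_ker As (splitting_eigen_ker As ar Ax).
  case/eqP: x0; apply: (proper_cone_neg pC l0); first exact: KC.
  by rewrite -Axl; apply: CA; exact: KC.
rewrite ar in Ax; have xE := splitting_dominant As Ax.
have Kker := free_ker _ _ _ _ _ pK Kfree (A1A i) Ain As.
have fx : 0 < (f *m x) 0 0.
  rewrite lt_neqAle (splitting_functional_ge0 As pK (Ku j) Kker Kx) andbT.
  by apply: contra_neq x0 => fx0; rewrite xE -fx0 scale0r.
(* For an edge on the dominant eigenline, a positive combination of [z] and [A i *m z] is sought on
   the ray of [x]. Taking [z] in the cone of the [u j] puts [A i *m z] in [K]. *)
have [_ _ _ _ [z Uz]] := pU; have Kz := intK _ Uz.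
have fz := splitting_functional_gt0 As pK (Ku j) Kker Kz.
have KAz : K (A i *m z).
  apply: (@cone_min _ _ (range u) [set x | K (A i *m x)]) (interior_subset Uz).
  - by move=> b w b0; rewrite /= -scalemxAr; exact: coneZ.
  - by move=> w w'; rewrite /= mulmxDr; exact: coneD.
  - by rewrite /= mulmx0; exact: proper_cone0.
  - by move=> _ [j' _ <-]; exact: KAu.
have [lr AE _ _] := As; case/andP: lr => _ lr.
(* The factor [(- l)^-1] cancels the term [l *: z] of [A i *m z] against [z], leaving a nonnegative
   multiple of [x] interior to [K], although its ray is on the boundary. *)
have Kw : interior K (z + (- l)^-1 *: (A i *m z)).
  apply: interior_addr => //; first exact: coneD.
  by apply: coneZ; rewrite // invr_ge0 oppr_ge0 ltW.
set t := (- l)^-1 * ((spectral_radius (A i) - l) * (f *m z) 0 0).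
have wE : z + (- l)^-1 *: (A i *m z) = (t / (f *m x) 0 0) *: x.
  rewrite [X in _ = _ *: X]xE scalerA divfK ?lt0r_neq0// /t AE.
  rewrite scalerDr !scalerA invrN mulNr mulVf ?lt_eqF// scaleN1r.
  by rewrite addrA subrr add0r.
rewrite wE in Kw; have [|_] := xbd (t / (f *m x) 0 0); last by [].
apply: divr_ge0; last exact: ltW.
apply: mulr_ge0; first by rewrite invr_ge0 oppr_ge0 ltW.
by apply: mulr_ge0; rewrite ltW// subr_gt0.
Qed.
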